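(* Let $m\ge 1$, and let $A_{k,p},B_{k,p}$ ($k\ge -1$, $0\le p\le m$) be the (Laurent) polynomials in $x$, depending on scalar seeds $b_{0,1},\dots,b_{0,m}$, defined in the context from the bivariate series $f(x,y)=\sum_{i,j\ge 0}c_{i,j}x^iy^j$ with $c_{0,0}=0$. Then for all $n>0$ the polynomials $A_{n,m}$, $B_{n,m}$ satisfy recursive relations of the form $$A_{n,m}=(1+\beta_n x)A_{n-1,m}+\alpha_n x^2A_{n-2,m}+\check A_{n,m},$$ $$B_{n,m}=(1+\beta_n x)B_{n-1,m}+\alpha_n x^2B_{n-2,m}+\check B_{n,m},$$ where $\alpha_n,\beta_n$ are the univariate Jacobi coefficients of $f(x,0)$ and $$\check A_{n,m}=\sum_{p=0}^{m-1}\left(x\,\check\beta^{n,m}_pA_{n-1,p}+x^2\check\alpha^{n,m}_pA_{n-2,p}\right),$$ $$\check B_{n,m}=\sum_{p=0}^{m-1}\left(x\,\check\beta^{n,m}_pB_{n-1,p}+x^2\check\alpha^{n,m}_pB_{n-2,p}\right).$$ Here the coefficients with $p=0$ are given by $$\check\beta^{n,m}_0=F^{(n)}_{2n-1}\sigma^{(m)}_{2n-1}+F^{(n)}_{2n}\sigma^{(m)}_{2n},\qquad \check\alpha^{n,m}_0=F^{(n-1)}_{2(n-1)}\sigma^{(m)}_{2n-1},$$ with $F^{(n)}_{2n-1},F^{(n)}_{2n},\sigma^{(m)}_{2n-1},\sigma^{(m)}_{2n}$ as defined in the context, while the coefficients with $p=1,\dots,m-1$ are copies of previous coefficients, in the sense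 that $$\check\beta^{n,m}_p=\check\beta^{n,m-s}_{p-s},\qquad \check\alpha^{n,m}_p=\check\alpha^{n,m-s}_{p-s},\qquad s=1,\dots,p,\quad p=1,\dots,m-1.$$
   Context: Let $f(x,y)=\sum_{i,j\ge 0}c_{i,j}x^iy^j$ be a formal power series with (real or complex) scalar coefficients and $c_{0,0}=0$; put $c_{i,j}=0$ if $i<0$. For $N,k\ge 0$ let $C_{N,k}(x)=\sum_{i=0}^{N}c_{i,k}x^i$. Standing assumption: for every $n\ge 1$ the $n\times n$ matrix $(c_{n+i-j,0})_{i,j=1}^n$ is nonsingular, so that the linear systems below are uniquely solvable. **The polynomials.** Put $b_{0,0}=1$ and let $b_{0,1},b_{0,2},\dots$ be arbitrary scalars (the seeds). For $n\ge 0$, $m\ge 0$, define inductively over $m$ polynomials in $x$ of degree at most $n$, $$A_{n,m}=\sum_{k=0}^n a^{(n)}_{k,m}x^k,\qquad B_{n,m}=\sum_{k=0}^n b^{(n)}_{k,m}x^k,\qquad b^{(n)}_{0,m}=b_{0,m},$$ by the requirement $$A_{n,m}-B_{n,0}C_{2n,m}-B_{n,1}C_{2n,m-1}-\dots-B_{n,m}C_{2n,0}=O(x^{2n+1}).$$ (The $x^{n+1},\dots,x^{2n}$ equations determine $B_{n,m}$, then the $x^0,\dots,x^n$ equations determine $A_{n,m}$.) For $m=0$, $A_{n,0}/B_{n,0}$ is the $[n/n]$ Padé approximant of $f(x,0)$ with $B_{n,0}(0)=1$. In particular $A_{0,0}=0$, $B_{0,0}=1$, and for $m\ge 1$, $A_{0,m}=c_{0,m}+b_{0,1}c_{0,m-1}+\dots+b_{0,m-1}c_{0,1}$,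 $B_{0,m}=b_{0,m}$. For index $-1$ set $A_{-1,0}=-x^{-1}$, $B_{-1,0}=0$, and $A_{-1,m}=B_{-1,m}=0$ for $m\ge1$. Coefficients $b^{(n)}_{k,m}$ with $k>n$ or $n=-1$ are $0$. **Errors.** For $n\ge 0$ let $E_{n,m}=A_{n,m}-\sum_{p=0}^m B_{n,p}C_{2n,m-p}$; let $E_{-1,0}=-x^{-1}$ and $E_{-1,m}=0$ for $m\ge 1$. Let $e^{n,m}_j$ be the coefficient of $x^j$ in $E_{n,m}$, and write $e^{(n)}_j=e^{n,0}_j$. **Univariate Jacobi coefficients.** For $n\ge 1$ let $D_n=c_{2n-1,0}-e^{(n-1)}_{2n-1}$, and $D_0=1$ (under the standing assumption all $D_n\neq 0$). Then $$\alpha_n=-\frac{D_n}{D_{n-1}},\qquad \beta_n=-\frac{1}{D_n}\Big\{b^{(n-1)}_{1,0}c_{2n-1,0}+c_{2n,0}-e^{(n-1)}_{2n}+\alpha_n\big[b^{(n-2)}_{0,0}c_{2n-2,0}+b^{(n-2)}_{1,0}c_{2n-3,0}-e^{(n-2)}_{2n-2}\big]\Big\},$$ so $\alpha_1=-c_{1,0}$ and $\beta_1=-c_{2,0}/c_{1,0}$. These are the coefficients in the univariate Jacobi formulas $A_{n,0}=(1+\beta_nx)A_{n-1,0}+\alpha_nx^2A_{n-2,0}$, $B_{n,0}=(1+\beta_nx)B_{n-1,0}+\alpha_nx^2B_{n-2,0}$ ($n\ge1$). **The quantities $F$.** $F^{(0)}_0=-1$, $F^{(1)}_1=0$, and $$F^{(n)}_{2n}=-\frac1{D_n}\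 (n\ge1),\qquad F^{(n)}_{2n-1}=-\frac{\tau^{(n-1)}_{2n-1,2n-2}}{D_n}\ (n\ge2),$$ where for $n\ge 2$ $$\tau^{(n-1)}_{2n-1,2n-2}=F^{(n-1)}_{2n-2}\big[b^{(n-2)}_{0,0}c_{2n-2,0}+b^{(n-2)}_{1,0}c_{2n-3,0}-e^{(n-2)}_{2n-2}\big].$$ **The quantities $\sigma$.** For $n,m\ge 1$, $\sigma^{(m)}_{2n-1}=\hat\sigma^{(m)}_{2n-1}+\check\sigma^{(m)}_{2n-1}$ and $\sigma^{(m)}_{2n}=\hat\sigma^{(m)}_{2n}+\check\sigma^{(m)}_{2n}$, where $$\hat\sigma^{(m)}_{2n-1}=-\big(e^{n-1,m}_{2n-1}+\alpha_ne^{n-2,m}_{2n-3}\big)+\sum_{p=0}^m\big(b^{(n-1)}_{0,p}c_{2n-1,m-p}+\alpha_nb^{(n-2)}_{0,p}c_{2n-3,m-p}\big),$$ $$\hat\sigma^{(m)}_{2n}=-\big(e^{n-1,m}_{2n}+\beta_ne^{n-1,m}_{2n-1}+\alpha_ne^{n-2,m}_{2n-2}\big)+\sum_{p=0}^m\Big\{b^{(n-1)}_{0,p}c_{2n,m-p}+\big(b^{(n-1)}_{1,p}+\beta_nb^{(n-1)}_{0,p}\big)c_{2n-1,m-p}+\alpha_n\big(b^{(n-2)}_{0,p}c_{2n-2,m-p}+b^{(n-2)}_{1,p}c_{2n-3,m-p}\big)\Big\},$$ $$\check\sigma^{(m)}_{2n-1}=\sum_{p=1}^{m-1}\check\alpha^{n,m}_p\Big\{-e^{n-2,p}_{2n-3}+\sum_{s=0}^pb^{(n-2)}_{0,s}c_{2n-3,p-s}\Big\},$$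 $$\check\sigma^{(m)}_{2n}=\sum_{p=1}^{m-1}\Big(\check\beta^{n,m}_p\Big\{-e^{n-1,p}_{2n-1}+\sum_{s=0}^pb^{(n-1)}_{0,s}c_{2n-1,p-s}\Big\}+\check\alpha^{n,m}_p\Big\{-e^{n-2,p}_{2n-2}+\sum_{s=0}^p\big(b^{(n-2)}_{0,s}c_{2n-2,p-s}+b^{(n-2)}_{1,s}c_{2n-3,p-s}\big)\Big\}\Big).$$ The $\check\alpha^{n,m}_p,\check\beta^{n,m}_p$ with $1\le p\le m-1$ occurring here are the ones of the claim, i.e. $\check\alpha^{n,m}_p=\check\alpha^{n,m-p}_0$ and $\check\beta^{n,m}_p=\check\beta^{n,m-p}_0$, so everything is defined recursively in $m$ for each $n$. *)

(* Defs.v *)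
From HB Require Import structures.
From mathcomp Require Import all_boot all_order all_algebra.

Set Implicit Arguments.
Unset Strict Implicit.
Unset Printing Implicit Defensive.

Import GRing.Theory.
Local Open Scope ring_scope.

(* MathComp's fraction.v only declares this notation locally. *)
Notation "p %:F" := (@tofrac _ p) : ring_scope.

Section Approximants.

Variables (K : fieldType) (c : nat -> nat -> K).

(* c i j is the coefficient of x^i y^j in f; coefZ extends it by 0 to i < 0. *)
Definition coefZ (i : int) (j : nat) : K :=
  if i is Posz k then c k j else 0.

Definition trunc_col (N k : nat) : {poly K} := \poly_(i < N.+1) c i k.

(* Row and column numbers start from 0, which leaves i - j unchanged; the     *)
(* truncated subtraction is harmless as j < n.                                *)
Definition pade_mx (n : nat) : 'M[K]_n :=
  \matrix_(i < n, j < n) c (n + i - j)%N 0%N.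

Variables A B : nat -> nat -> {poly K}.

Definition error_poly (n m : nat) : {poly K} :=
  A n m - \sum_(p < m.+1) B n p * trunc_col (2 * n)%N (m - p)%N.

Definition approximants (b0 : nat -> K) : Prop :=
  forall n m : nat,
    [/\ (size (A n m) <= n.+1)%N, (size (B n m) <= n.+1)%N,
        (B n m)`_0 = b0 m & 'X^(2 * n + 1)%N %| error_poly n m].

(* Extensions to the index n = -1 (all negative n are treated alike, but only *)
(* -1 is ever used).  As A_{-1,0} = - x^-1, A takes its values in K(x).       *)
Definition extA (n : int) (m : nat) : {fraction {poly K}} :=
  match n with
  | Posz k => (A k m)%:F
  | Negz _ => if m == 0%N then - ('X%:F)^-1 else 0
  end.

Definition extB (n : int) (m : nat) : {poly K} :=
  if n is Posz k then B k m else 0.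

(* errc n m j is the coefficient of x^j in E_{n,m}, where E_{-1,0} = - x^-1.  *)
Definition errc (n : int) (m : nat) (j : int) : K :=
  match n, j with
  | Posz k, Posz i => (error_poly k m)`_i
  | Posz _, Negz _ => 0
  | Negz _, _ => if (m == 0%N) && (j == -1) then -1 else 0
  end.

(* bc n k m is b^{(n)}_{k,m}. *)
Definition bc (n : int) (k m : nat) : K := (extB n m)`_k.

Definition jacD (n : nat) : K :=
  if n == 0%N then 1
  else coefZ (2 * n%:Z - 1) 0 - errc (n%:Z - 1) 0 (2 * n%:Z - 1).

Definition bracket (n : nat) : K :=
  bc (n%:Z - 2) 0 0 * coefZ (2 * n%:Z - 2) 0
  + bc (n%:Z - 2) 1 0 * coefZ (2 * n%:Z - 3) 0
  - errc (n%:Z - 2) 0 (2 * n%:Z - 2).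

Definition alpha (n : nat) : K := - (jacD n / jacD n.-1).

Definition beta (n : nat) : K :=
  - ((jacD n)^-1 *
     (bc (n%:Z - 1) 1 0 * coefZ (2 * n%:Z - 1) 0 + coefZ (2 * n%:Z) 0
      - errc (n%:Z - 1) 0 (2 * n%:Z) + alpha n * bracket n)).

(* F_even n = F^{(n)}_{2n} for n >= 0, F_odd n = F^{(n)}_{2n-1} for n >= 1,   *)
(* and tau n = tau^{(n-1)}_{2n-1,2n-2} for n >= 2.                            *)
Definition F_even (n : nat) : K := if n == 0%N then -1 else - (jacD n)^-1.

Definition tau (n : nat) : K := F_even n.-1 * bracket n.

Definition F_odd (n : nat) : K :=
  if (n <= 1)%N then 0 else - (tau n / jacD n).

Definition hsigma_odd (n m : nat) : K :=
  - (errc (n%:Z - 1) m (2 * n%:Z - 1)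
     + alpha n * errc (n%:Z - 2) m (2 * n%:Z - 3))
  + \sum_(0 <= p < m.+1)
      (bc (n%:Z - 1) 0 p * coefZ (2 * n%:Z - 1) (m - p)
       + alpha n * bc (n%:Z - 2) 0 p * coefZ (2 * n%:Z - 3) (m - p)).

Definition hsigma_even (n m : nat) : K :=
  - (errc (n%:Z - 1) m (2 * n%:Z)
     + beta n * errc (n%:Z - 1) m (2 * n%:Z - 1)
     + alpha n * errc (n%:Z - 2) m (2 * n%:Z - 2))
  + \sum_(0 <= p < m.+1)
      (bc (n%:Z - 1) 0 p * coefZ (2 * n%:Z) (m - p)
       + (bc (n%:Z - 1) 1 p + beta n * bc (n%:Z - 1) 0 p)
         * coefZ (2 * n%:Z - 1) (m - p)
       + alpha n * (bc (n%:Z - 2) 0 p * coefZ (2 * n%:Z - 2) (m - p)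
                    + bc (n%:Z - 2) 1 p * coefZ (2 * n%:Z - 3) (m - p))).

(* The coefficients of \check A and \check B, with arguments n, m and p; the  *)
(* quantities sigma below at level m only use them for 1 <= p < m.            *)
Variables alphac betac : nat -> nat -> nat -> K.

Definition csigma_odd (n m : nat) : K :=
  \sum_(1 <= p < m) alphac n m p *
    (- errc (n%:Z - 2) p (2 * n%:Z - 3)
     + \sum_(0 <= s < p.+1) bc (n%:Z - 2) 0 s * coefZ (2 * n%:Z - 3) (p - s)).

Definition csigma_even (n m : nat) : K :=
  \sum_(1 <= p < m)
    (betac n m p *
       (- errc (n%:Z - 1) p (2 * n%:Z - 1)
        + \sum_(0 <= s < p.+1)
            bc (n%:Z - 1) 0 s * coefZ (2 * n%:Z - 1) (p - s))
     + alphac n m p *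
       (- errc (n%:Z - 2) p (2 * n%:Z - 2)
        + \sum_(0 <= s < p.+1)
            (bc (n%:Z - 2) 0 s * coefZ (2 * n%:Z - 2) (p - s)
             + bc (n%:Z - 2) 1 s * coefZ (2 * n%:Z - 3) (p - s)))).

Definition sigma_odd (n m : nat) : K := hsigma_odd n m + csigma_odd n m.

Definition sigma_even (n m : nat) : K := hsigma_even n m + csigma_even n m.

Definition checkA (n m : nat) : {fraction {poly K}} :=
  \sum_(0 <= p < m)
    ((betac n m p *: 'X)%:F * extA (n%:Z - 1) p
     + (alphac n m p *: 'X^2)%:F * extA (n%:Z - 2) p).

Definition checkB (n m : nat) : {poly K} :=
  \sum_(0 <= p < m)
    ((betac n m p *: 'X) * extB (n%:Z - 1) p
     + (alphac n m p *: 'X^2) * extB (n%:Z - 2) p).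

End Approximants.

(* The requirements on A and B can be met, so they do define polynomials. *)
Lemma approximants_exist (K : fieldType) (c : nat -> nat -> K) (b0 : nat -> K) :
  (forall n, (0 < n)%N -> pade_mx c n \in unitmx) ->
  exists A B, approximants c A B b0.
Proof.
move=> c_reg.
pose sol n (r : {poly K}) : 'cV[K]_n :=
  invmx (pade_mx c n) *m \col_(i < n) - r`_(n.+1 + i).
pose next n b (r : {poly K}) : {poly K} :=
  b%:P + 'X * \poly_(k < n)
    (if insub k is Some i then
       sol n (b *: trunc_col c (2 * n)%N 0%N + r) i 0
     else 0).
pose rest n m (s : seq {poly K}) : {poly K} :=
  \sum_(p < m) s`_p * trunc_col c (2 * n)%N (m - p)%N.
pose Bs := fix Bs n m : seq {poly K} :=
  if m is m'.+1 then rcons (Bs n m') (next n (b0 m') (rest n m' (Bs n m')))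
  else [::].
pose B n m := next n (b0 m) (rest n m (Bs n m)).
have sBs n m : size (Bs n m) = m by elim: m => //= m IH; rewrite size_rcons IH.
have BsE n m p : (p < m)%N -> (Bs n m)`_p = B n p.
  elim: m => // m IH; rewrite ltnS leq_eqVlt nth_rcons sBs => /orP[/eqP->|lt_pm].
    by rewrite ltnn eqxx.
  by rewrite lt_pm IH.
pose S n m := \sum_(p < m.+1) B n p * trunc_col c (2 * n)%N (m - p)%N.
exists (fun n m => take_poly n.+1 (S n m)), B => n m; split.
- exact: size_take_poly.
- rewrite (leq_trans (size_polyD _ _)) // geq_max.
  rewrite (leq_trans (size_polyC_leq1 _)) //=.
  by rewrite (leq_trans (size_polyMleq _ _)) // size_polyX /= ltnS size_poly.
- by rewrite coefD coefC /= coefXM addr0.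
rewrite /error_poly -/(S n m).
suff Sj i : (i < n)%N -> (S n m)`_(n.+1 + i) = 0.
  rewrite -[X in _ - X](poly_take_drop n.+1) opprD addNKr dvdpNr.
  rewrite -(poly_take_drop n (drop_poly n.+1 _)).
  have -> : take_poly n (drop_poly n.+1 (S n m)) = 0.
    apply/polyP=> i; rewrite coef0 coef_take_poly coef_drop_poly addnC.
    by case: ifP => // /Sj.
  rewrite add0r -mulrA -exprD. by apply: dvdp_mull; rewrite addn1 addnS addnn mul2n dvdpp.
move=> lt_in; rewrite /S big_ord_recr /= subnn.
have -> : \sum_(p < m) B n p * trunc_col c (2 * n)%N (m - p)%N = rest n m (Bs n m).
  by apply: eq_bigr => p _; rewrite BsE.
rewrite /B /next; set r := rest n m _; set C := trunc_col c (2 * n)%N 0%N.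
rewrite mulrDl mul_polyC addrA; set r' := _ *: C + r.
rewrite addrC [r + _]addrC -mulrA -/r' coefD addSn coefXM /= coefM.
set P := \poly_(k < n) _.
rewrite -(big_mkord xpredT (fun j => P`_j * C`_(n + i - j))).
rewrite (@big_cat_nat _ _ _ n) /= ?leqW ?leq_addr //.
rewrite [X in _ + X + _]big1_seq ?addr0 => [|j]; last first.
  rewrite mem_index_iota => /andP[_ /andP[le_nj _]].
  by rewrite coef_poly ltnNge le_nj mul0r.
have n_gt0 : (0 < n)%N by case: (n) lt_in.
have /matrixP/(_ (Ordinal lt_in) 0) :
    pade_mx c n *m sol n r' = \col_i - r'`_(n.+1 + i).
  by rewrite mulmxA mulmxV ?mul1mx ?c_reg.
rewrite !mxE /= addSn => /eqP; rewrite -addr_eq0 => /eqP sol_i.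
rewrite -[RHS]sol_i big_mkord; congr (_ + _); apply: eq_bigr => j _.
rewrite coef_poly ltn_ord valK mxE /= mulrC; congr (_ * _).
rewrite coef_poly ltnS (leq_trans (leq_subr _ _)) ?mxE //.
by rewrite mul2n -addnn leq_add2l ltnW.
Qed.

(* Main.v *)
(* Put a(y) = alpha_n + \sum_(k >= 1) alphac_0^(n,k) y^k, and b(y) likewise   *)
(* from beta_n and betac_0^(n,k).  As the coefficients with p > 0 are copies, *)
(* the claim says that the generating series in y of A_{n,m} and B_{n,m}      *)
(* satisfy Z_n = (1 + x b(y)) Z_{n-1} + x^2 a(y) Z_{n-2}.  The right-hand     *)
(* side is linear over K[[y]], so the residual series A - f B obey the same   *)
(* rule, and the formulas for alpha, beta, F and sigma say exactly that the   *)
(* coefficients of x^(2n-1) and x^(2n) of the new residual vanish.  The       *)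
(* right-hand side hence meets the requirements defining A_{n,m} and B_{n,m}, *)
(* and these have a unique solution because the Pade matrices are invertible. *)
Require Import Defs.
From HB Require Import structures.
From mathcomp Require Import all_boot all_order all_algebra.
From mathcomp Require Import ring zify.

Set Implicit Arguments.
Unset Strict Implicit.
Unset Printing Implicit Defensive.

Import GRing.Theory.
Local Open Scope ring_scope.

(** With the copies built in, all unknown coefficients form two series in y, whose y^m coefficients
    are found by recursion on m ([strong_recE]). By [next_residual] the candidate built from levels
    n-1 and n-2 has a residual given by the same recursion, and [next_approximants_at] shows that
    only its coefficients of x^(2n-1) and x^(2n) can obstruct. At each m this is a triangular 2 by 2
    system for the new alpha and beta coefficients; its pivots are nonzero by [residual_lead_neq0],
    and [alphac_balance] and [betac_balance] verify that the closed formulas solve it. Then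
    [approximants_at_uniq] identifies the candidate with A_{n,m}, B_{n,m}. *)

(** * Course-of-values recursion *)

Section StrongRecursion.

Variables (T : Type) (t0 : T) (step : nat -> (nat -> T) -> T).

Definition strong_rec (m : nat) : T :=
  iter m.+1 (fun f k => step k f) (fun=> t0) m.

(** The value at m is already stable after m+1 iterations, because [step m] reads only values below
    m. *)
Lemma strong_recE :
    (forall m f g, (forall k, (k < m)%N -> f k = g k) -> step m f = step m g) ->
  forall m, strong_rec m = step m strong_rec.
Proof.
move=> step_ext m.
suff stable d k : (k < d)%N ->
    iter d (fun f k => step k f) (fun=> t0) k = strong_rec k.
  by rewrite {1}/strong_rec iterS; apply: step_ext => k /stable.
elim/ltn_ind: k d => k IHk [//|d] lt_kd; rewrite /strong_rec !iterS.
by apply: step_ext => j lt_jk; rewrite !IHk // (leq_trans lt_jk).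
Qed.

End StrongRecursion.

(** * Truncated products and uniqueness of the approximants *)

Section PowerSeries.

Variables (K : fieldType) (c : nat -> nat -> K).
Implicit Types (P Q : {poly K}).

Lemma dvdXnP d P :
  reflect (forall i, (i < d)%N -> P`_i = 0) ('X^d %| P).
Proof.
apply: (iffP idP) => [/dvdpP[q ->] i lt_id | P0].
  by rewrite coefMXn lt_id.
rewrite -(poly_take_drop d P) (_ : take_poly d P = 0) ?add0r ?dvdp_mull //.
by apply/polyP=> i; rewrite coef0 coef_take_poly; case: ifP => // /P0.
Qed.

Lemma coef_trunc_colB M N q j : (M <= N)%N ->
  (trunc_col c N q - trunc_col c M q)`_j =
  if (M < j <= N)%N then c j q else 0.
Proof.
move=> le_MN; rewrite coefB !coef_poly !ltnS.
case: (ltnP M j) => [lt_Mj|le_jM] /=; first by rewrite subr0.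
by rewrite (leq_trans le_jM le_MN) subrr.
Qed.

Lemma coefM_trunc_col_low M N P q i : (i <= M <= N)%N ->
  (P * trunc_col c N q)`_i = (P * trunc_col c M q)`_i.
Proof.
move=> /andP[le_iM le_MN]; apply/eqP; rewrite -subr_eq0 -coefB -mulrBr coefM.
rewrite big1 // => j _; rewrite coef_trunc_colB // ltnNge.
by rewrite (leq_trans (leq_subr _ _)) // mulr0.
Qed.

Lemma coefM_trunc_colS M N P q : (M < N)%N ->
  (P * trunc_col c N q)`_M.+1 =
  (P * trunc_col c M q)`_M.+1 + P`_0 * c M.+1 q.
Proof.
move=> lt_MN; apply/eqP; rewrite addrC -subr_eq -coefB -mulrBr coefM.
rewrite big_ord_recl big1 => [|j _]; rewrite coef_trunc_colB ?(ltnW lt_MN) //.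
  by rewrite subn0 ltnSn lt_MN addr0.
by rewrite lift0 subSS ltnNge leq_subr mulr0.
Qed.

Lemma coefM_trunc_colSS M N P q : (M.+1 < N)%N ->
  (P * trunc_col c N q)`_M.+2 =
  (P * trunc_col c M q)`_M.+2 + (P`_0 * c M.+2 q + P`_1 * c M.+1 q).
Proof.
move=> lt_MN; have le_MN : (M <= N)%N by lia.
apply/eqP; rewrite addrC -subr_eq -coefB -mulrBr coefM.
rewrite 2!big_ord_recl big1 => [|j _]; rewrite !coef_trunc_colB //.
  by rewrite lift0 !ifT ?subn0 ?subn1 ?addr0 //=; lia.
by rewrite ifF ?mulr0 // !lift0; lia.
Qed.

(** The coefficients of x^n, ..., x^(2n-1) of the product are the entries of the Pade matrix applied
    to the coefficient vector of P. *)
Lemma pade_kernel n P : pade_mx c n \in unitmx -> (size P <= n)%N ->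
    (forall i, (i < n)%N -> (P * trunc_col c (2 * n) 0)`_(n + i) = 0) ->
  P = 0.
Proof.
move=> c_reg sP P0; pose b : 'cV[K]_n := \col_j P`_j.
have: pade_mx c n *m b = 0.
  apply/matrixP=> i j; rewrite !mxE -[RHS](P0 i) // coefM.
  rewrite -(big_mkord xpredT
    (fun j => P`_j * (trunc_col c (2 * n) 0)`_(n + i - j))).
  rewrite (@big_cat_nat _ _ _ n) /= ?leqW ?leq_addr //.
  rewrite [X in _ + X]big_nat_cond [X in _ + X]big1 ?addr0 => [|l]; last first.
    by case/andP=> /andP[le_nl _] _; rewrite nth_default ?mul0r ?(leq_trans sP).
  rewrite big_mkord; apply: eq_bigr => l _; rewrite !mxE mulrC; congr (_ * _).
  by rewrite coef_poly ifT //; have := ltn_ord i; lia.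
move/(congr1 (mulmx (invmx (pade_mx c n)))); rewrite mulKmx // mulmx0.
move=> /matrixP b0; apply/polyP=> i; rewrite coef0.
have [lt_in|le_ni] := ltnP i n; last by rewrite nth_default ?(leq_trans sP).
by have := b0 (Ordinal lt_in) 0; rewrite !mxE.
Qed.

Definition approximants_at (b0 : nat -> K) n (A B : nat -> {poly K}) : Prop :=
  forall m,
    [/\ (size (A m) <= n.+1)%N, (size (B m) <= n.+1)%N, (B m)`_0 = b0 m
      & 'X^(2 * n + 1)%N %|
          A m - \sum_(p < m.+1) B p * trunc_col c (2 * n) (m - p)].

(** By induction on m the terms with p < m cancel, leaving a homogeneous univariate Pade problem for
    the differences, in which B - B' has zero constant term. *)
Lemma approximants_at_uniq b0 n A B A' B' :
    (forall n, (0 < n)%N -> pade_mx c n \in unitmx) ->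
    approximants_at b0 n A B -> approximants_at b0 n A' B' ->
  forall m, A m = A' m /\ B m = B' m.
Proof.
move=> c_reg apx apx'; elim/ltn_ind=> m IHm.
have [sA sB B0 /dvdXnP E0] := apx m; have [sA' sB' B0' /dvdXnP E0'] := apx' m.
set C := trunc_col c (2 * n) 0.
have EE i : (i <= 2 * n)%N -> (A m - A' m)`_i = ((B m - B' m) * C)`_i.
  move=> le_i; apply/eqP; rewrite -subr_eq0 -coefB.
  have lt_i : (i < 2 * n + 1)%N by rewrite addn1.
  have := congr2 (fun a b => a - b) (E0 i lt_i) (E0' i lt_i).
  rewrite subrr -coefB => EE0; apply/eqP; apply: etrans EE0.
  apply: (congr1 (fun P : {poly K} => P`_i)); rewrite !big_ord_recr /= subnn -/C.
  rewrite (eq_bigr (fun p : 'I_m => B' p * trunc_col c (2 * n) (m - p))).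
    by ring.
  by move=> p _; have [_ ->] := IHm p (ltn_ord p).
have sAA : (size (A m - A' m)%R <= n.+1)%N.
  by rewrite (leq_trans (size_polyD _ _)) // geq_max size_polyN sA.
have sBB : (size (B m - B' m)%R <= n.+1)%N.
  by rewrite (leq_trans (size_polyD _ _)) // geq_max size_polyN sB.
have BB : B m - B' m = 0.
  have /dvdXnP/dvdpP[P defP] : forall i, (i < 1)%N -> (B m - B' m)`_i = 0.
    by case=> // _; rewrite coefB B0 B0' subrr.
  have [n0|n_gt0] := posnP n.
    apply/polyP=> -[|i]; first by rewrite coefB B0 B0' subrr coef0.
    by rewrite coef0 nth_default // (leq_trans sBB) // n0.
  (* Dividing B - B' by x leaves P of size at most n, and turns the equations at x^(n+1), ...,
     x^(2n), where A - A' has no terms, into those of [pade_kernel]. *)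
  rewrite defP expr1 (_ : P = 0) ?mul0r //; apply: (pade_kernel (c_reg n n_gt0)).
    have [->|P_neq0] := eqVneq P 0; first by rewrite size_poly0.
    by move: sBB; rewrite defP expr1 size_mulX.
  move=> i lt_in; have := EE (n + i).+1; rewrite nth_default; last first.
    by rewrite (leq_trans sAA) // ltnS leq_addr.
  rewrite defP expr1 -mulrA [_ * (_ * C)]mulrCA coefXM /= => <- //.
  by rewrite mul2n -addnn ltn_add2l.
split; last by apply/eqP; rewrite -subr_eq0 BB.
apply/eqP; rewrite -subr_eq0; apply/eqP/polyP=> i; rewrite coef0.
have [le_i|gt_i] := leqP i (2 * n); first by rewrite EE // BB mul0r coef0.
by rewrite nth_default // (leq_trans sAA) //; lia.
Qed.

End PowerSeries.

(** * Coefficients of the residuals A - f B *)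

Section Residuals.

Variables (K : fieldType) (c : nat -> nat -> K) (A B : nat -> nat -> {poly K}).

(* Indices are shifted by one, so that k stands for n = k - 1 >= -1, and      *)
(* shiftA k m is x A_{k-1,m}, which is a polynomial for k = 0 too.            *)
Definition shiftA (k m : nat) : {poly K} :=
  if k is k'.+1 then 'X * A k' m else - (m == 0%N)%:R.

Definition shiftB (k m : nat) : {poly K} := extB B (k%:Z - 1) m.

(* x (A_{k-1,m} - \sum_p B_{k-1,p} f_{m-p}) up to O(x^(N+2)), where f_q is    *)
(* the coefficient of y^q in f.                                               *)
Definition residual (N k m : nat) : {poly K} :=
  shiftA k m - 'X * \sum_(p < m.+1) shiftB k p * trunc_col c N (m - p).

Lemma predS k : k.+1%:Z - 1 = k.
Proof. by rewrite -addn1 PoszD addrK. Qed.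

Lemma shiftBS k : shiftB k.+1 = B k.
Proof. by rewrite /shiftB predS. Qed.

Lemma extA_pred k m : (shiftA k m)%:F = 'X%:F * extA A (k%:Z - 1) m.
Proof.
case: k => [|k]; last by rewrite predS /= tofracM.
have X_neq0 : 'X%:F != 0 :> {fraction {poly K}}.
  by rewrite tofrac_eq0 polyX_eq0.
by case: m => [|m] /=; rewrite ?mulr0 ?mulrN ?mulfV // ?oppr0 ?tofrac0 ?tofracN ?tofrac1.
Qed.

(** E_{k-1,m} truncates f at degree 2(k-1), so at x^(2k-1) it misses just the terms b_{0,p}
    c_{2k-1,m-p}. The left-hand side, a pattern recurring in the sigmas, restores them. *)
Lemma residual_lead_coef N k m : (2 * k <= N.+1)%N ->
  - errc c A B (k%:Z - 1) m (2 * k%:Z - 1)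
  + \sum_(0 <= p < m.+1)
      bc B (k%:Z - 1) 0 p * Defs.coefZ c (2 * k%:Z - 1) (m - p)
  = - (residual N k m)`_(2 * k)%N.
Proof.
case: k => [|k] le_kN.
  rewrite /errc /residual /= andbT big1 ?addr0; last first.
    by move=> p _; rewrite /bc /= mulr0.
  rewrite big1 ?mulr0 ?subr0; last by move=> p _; rewrite mul0r.
  by case: m => [|m] /=; rewrite coefN ?coef1 ?coef0 ?oppr0.
have -> : 2 * k.+1%:Z - 1 = (2 * k)%N.+1%:Z by lia.
rewrite /bc /errc /residual shiftBS.
rewrite predS.
rewrite /error_poly mulnS /= -mulrBr coefXM /= !coefB !coef_sum !opprB addrAC.
rewrite big_mkord; congr (_ - _); rewrite addrC -big_split /=.
by apply: eq_bigr => p _; rewrite addrC (@coefM_trunc_colS _ _ (2 * k) N) //; lia.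
Qed.

Lemma residual_next_coef N k m : (2 * k < N.+1)%N ->
  - errc c A B (k%:Z - 1) m (2 * k%:Z)
  + \sum_(0 <= p < m.+1)
      (bc B (k%:Z - 1) 0 p * Defs.coefZ c (2 * k%:Z) (m - p)
       + bc B (k%:Z - 1) 1 p * Defs.coefZ c (2 * k%:Z - 1) (m - p))
  = - (residual N k m)`_(2 * k)%N.+1.
Proof.
case: k => [|k] lt_kN.
  rewrite /errc /residual /= andbF big1 ?addr0; last first.
    by move=> p _; rewrite /bc /= !coef0 !mul0r addr0.
  rewrite big1 ?mulr0 ?subr0; last by move=> p _; rewrite mul0r.
  by case: m => [|m] /=; rewrite coefN ?coef1 ?coef0 ?oppr0.
have -> : 2 * k.+1%:Z - 1 = (2 * k)%N.+1%:Z by lia.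
have -> : 2 * k.+1%:Z = (2 * k)%N.+2%:Z by lia.
rewrite /bc /errc /residual shiftBS.
rewrite predS.
rewrite /error_poly mulnS /= -mulrBr coefXM /= !coefB !coef_sum !opprB addrAC.
rewrite big_mkord; congr (_ - _); rewrite addrC -big_split /=.
by apply: eq_bigr => p _; rewrite addrC (@coefM_trunc_colSS _ _ (2 * k) N) //; lia.
Qed.

Lemma residual_low_coef b0 N k m j : approximants c A B b0 ->
  (2 * k <= N.+1)%N -> (j < 2 * k)%N -> (residual N k m)`_j = 0.
Proof.
move=> apx; case: k => // k le_kN lt_jk.
have [_ _ _ /dvdXnP E0] := apx k m.
rewrite /residual shiftBS /= -mulrBr coefXM; case: j lt_jk => //= j lt_jk.
have lt_j : (j < 2 * k + 1)%N by lia.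
rewrite -[RHS](E0 j lt_j) /error_poly !coefB !coef_sum; congr (_ - _).
by apply: eq_bigr => p _; apply: coefM_trunc_col_low; lia.
Qed.

(** This is D_k <> 0. Were the coefficient zero, B_{k-1,0} would satisfy k homogeneous equations
    with the invertible k by k Pade matrix, hence vanish, against its constant term 1. *)
Lemma residual_lead_neq0 b0 N k : approximants c A B b0 -> b0 0%N = 1 ->
    (forall n, (0 < n)%N -> pade_mx c n \in unitmx) ->
  (2 * k <= N.+1)%N -> (residual N k 0)`_(2 * k)%N != 0.
Proof.
move=> apx b00 c_reg le_kN; case: k le_kN => [|k] le_kN.
  rewrite /residual big_ord1 mul0r mulr0 subr0 /= coefN coef1.
  by rewrite oppr_eq0 oner_eq0.
have [sA sB B0 _] := apx k 0%N; apply/eqP => r0.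
have rem0 j : (j <= 2 * k.+1)%N -> (residual N k.+1 0)`_j = 0.
  rewrite leq_eqVlt => /predU1P[-> //|lt_j].
  exact: residual_low_coef apx le_kN lt_j.
have BP0 : B k 0%N = 0.
  apply: (pade_kernel (c_reg k.+1 isT)) => // i lt_ik.
  have := rem0 (k.+1 + i).+1; rewrite /residual big_ord1 subn0 shiftBS.
  rewrite /= -mulrBr coefXM /= coefB [in X in X - _]nth_default; last first.
    by rewrite (leq_trans sA) // leq_addr.
  (* N may lie on either side of the truncation degree in [pade_kernel]; both products are compared
     at the smaller one. *)
  rewrite sub0r (@coefM_trunc_col_low _ _ (minn N (2 * k.+1)) N); last by lia.
  rewrite (@coefM_trunc_col_low _ _ (minn N (2 * k.+1)) (2 * k.+1)%N); last by lia.
  by move/(_ _)/eqP; rewrite oppr_eq0 => h; apply/eqP/h; lia.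
by move: B0; rewrite BP0 coef0 b00 => /eqP; rewrite eq_sym oner_eq0.
Qed.

End Residuals.

(** * The recurrence and its effect on residuals *)

(** Associativity of the Cauchy product in y, read off from polynomials truncated at degree m; it
    gives linearity over K[[y]]. *)
Lemma convolutionA (R : comNzRingType) (s F G : nat -> R) m :
  \sum_(p < m.+1) (\sum_(q < p.+1) s (p - q)%N * F q) * G (m - p)%N
  = \sum_(q < m.+1) s (m - q)%N * \sum_(p < q.+1) F p * G (q - p)%N.
Proof.
pose ser (F : nat -> R) := \poly_(i < m.+1) F i.
have serE H i : (i <= m)%N -> (ser H)`_i = H i.
  by move=> le_im; rewrite coef_poly ltnS le_im.
transitivity (ser s * ser F * ser G)`_m.
  rewrite coefM; apply: eq_bigr => p _; have le_pm := ltn_ord p.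
  rewrite coefMr serE ?leq_subr //; congr (_ * _).
  by apply: eq_bigr => q _; have lt_q := ltn_ord q; rewrite !serE //; lia.
rewrite -mulrA coefMr; apply: eq_bigr => q _; have le_qm := ltn_ord q.
rewrite serE ?leq_subr // coefM; congr (_ * _).
by apply: eq_bigr => p _; have lt_p := ltn_ord p; rewrite !serE //; lia.
Qed.

Section Recurrence.

Variables (K : fieldType) (c : nat -> nat -> K) (A B : nat -> nat -> {poly K}).
Variables (k : nat) (a b : nat -> K).

(** The second factor is 'X and not 'X^2 because [shiftA] already carries one x. *)
Definition nextA (m : nat) : {poly K} :=
  A k m + \sum_(p < m.+1) ((b (m - p)%N *: 'X) * A k p
                           + (a (m - p)%N *: 'X) * shiftA A k p).

Definition nextB (m : nat) : {poly K} :=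
  B k m + \sum_(p < m.+1) ((b (m - p)%N *: 'X) * B k p
                           + (a (m - p)%N *: 'X^2) * shiftB B k p).

Lemma next_residual N m :
  'X * (nextA m - \sum_(p < m.+1) nextB p * trunc_col c N (m - p))
  = residual c A B N k.+1 m + \sum_(p < m.+1)
      ((b (m - p)%N *: 'X) * residual c A B N k.+1 p
       + (a (m - p)%N *: 'X^2) * residual c A B N k p).
Proof.
rewrite /nextA /nextB /residual shiftBS.
under [X in _ - X]eq_bigr do rewrite mulrDl big_split mulrDl /=.
rewrite !big_split /=.
rewrite (@convolutionA _ (fun j => b j *: 'X) (B k) (trunc_col c N)).
rewrite (@convolutionA _ (fun j => a j *: 'X^2) (shiftB B k) (trunc_col c N)).
set SA := \sum_(i < m.+1) _ * A k i; set SA' := \sum_(i < m.+1) _ * shiftA A k i.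
set SB := \sum_(q < m.+1) _ * \sum_(_ < _) B k _ * _.
set SB' := \sum_(q < m.+1) _ * \sum_(_ < _) shiftB B k _ * _.
rewrite [X in _ = _ + (X + _)](_ : _ = 'X * SA - 'X * SB); last first.
  rewrite -mulrBr -sumrB mulr_sumr; apply: eq_bigr => i _.
  by rewrite -!mul_polyC; ring.
rewrite [X in _ = _ + (_ + X)](_ : _ = 'X * SA' - 'X * SB'); last first.
  rewrite -mulrBr -sumrB mulr_sumr; apply: eq_bigr => i _.
  by rewrite -!mul_polyC; ring.
by rewrite /=; ring.
Qed.

(** With n = k+1, each term of the new residual is O(x^(2n-1)) by [residual_low_coef], so only
    x^(2n-1) and x^(2n) remain; the two hypotheses kill these. *)
Lemma next_approximants_at b0 : (approximants c A B b0) ->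
  (forall m, (residual c A B (2 * k.+1) k.+1 m)`_(2 * k)%N.+2
     + \sum_(p < m.+1) a (m - p)%N * (residual c A B (2 * k.+1) k p)`_(2 * k)%N
     = 0) ->
  (forall m, (residual c A B (2 * k.+1) k.+1 m)`_(2 * k)%N.+3
     + \sum_(p < m.+1)
         (b (m - p)%N * (residual c A B (2 * k.+1) k.+1 p)`_(2 * k)%N.+2
          + a (m - p)%N * (residual c A B (2 * k.+1) k p)`_(2 * k)%N.+1)
     = 0) ->
  approximants_at c b0 k.+1 nextA nextB.
Proof.
move=> apx odd0 even0 m; have [sA sB B0 _] := apx k m.
have sX (d : K) n (P : {poly K}) :
    (size P <= n)%N -> (size (d *: 'X * P)%R <= n.+1)%N.
  move=> sP; rewrite -scalerAl (leq_trans (size_scale_leq _ _)) //.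
  by rewrite (leq_trans (size_polyMleq _ _)) // size_polyX.
have sX1 n (P : {poly K}) : (size P <= n)%N -> (size ('X * P)%R <= n.+1)%N.
  by move/(sX 1); rewrite scale1r.
split.
- rewrite (leq_trans (size_polyD _ _)) // geq_max (leq_trans sA) //=.
  rewrite (leq_trans (size_sum _ _ _)) //; apply/bigmax_leqP => p _.
  rewrite (leq_trans (size_polyD _ _)) // geq_max !sX //.
    case: (k) => [|k'] /=; last by have [sAp _ _ _] := apx k' p; apply: sX1.
    by rewrite size_polyN -polyC_natr size_polyC_leq1.
  by have [] := apx k p.
- rewrite (leq_trans (size_polyD _ _)) // geq_max (leq_trans sB) //=.
  rewrite (leq_trans (size_sum _ _ _)) //; apply/bigmax_leqP => p _.
  rewrite (leq_trans (size_polyD _ _)) // geq_max sX; last by have [] := apx k p.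
  rewrite expr2 scalerAl -mulrA sX //.
  case: (k) => [|k']; first by rewrite mulr0 size_poly0.
  by rewrite shiftBS sX1 //; have [] := apx k' p.
- rewrite /nextB coefD B0 coef_sum big1 ?addr0 // => p _.
  by rewrite coefD -!scalerAl !coefZ coefXM coefXnM /= !mulr0 addr0.
apply/dvdXnP => i; rewrite addn1 ltnS => le_i.
have := congr1 (fun P : {poly K} => P`_i.+1) (next_residual (2 * k.+1) m).
rewrite coefXM /= => ->; rewrite coefD coef_sum.
have coefp_ p : ((b (m - p)%N *: 'X) * residual c A B (2 * k.+1) k.+1 p
    + (a (m - p)%N *: 'X^2) * residual c A B (2 * k.+1) k p)`_i.+1
  = b (m - p)%N * (residual c A B (2 * k.+1) k.+1 p)`_i
    + a (m - p)%N * (if i is i'.+1 then (residual c A B (2 * k.+1) k p)`_i' else 0).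
  rewrite coefD -!scalerAl !coefZ coefXM coefXnM /=.
  by case: (i) => [|i'] //=; rewrite !subSS subn0.
under eq_bigr do rewrite coefp_.
have low1 p j : (j < (2 * k).+2)%N -> (residual c A B (2 * k.+1) k.+1 p)`_j = 0.
  by move=> lt_j; apply: residual_low_coef apx _ _; lia.
have low0 p j : (j < 2 * k)%N -> (residual c A B (2 * k.+1) k p)`_j = 0.
  by apply: residual_low_coef apx _; lia.
move: le_i; rewrite [X in (_ <= X)%N]mulnS add2n leq_eqVlt => /predU1P[->|]; first exact: even0.
rewrite !ltnS leq_eqVlt => /predU1P[->|lt_i].
  rewrite -[RHS](odd0 m); congr (_ + _); apply: eq_bigr => p _.
  by rewrite low1 // mulr0 add0r.
rewrite low1 // big1 ?addr0 // => p _; rewrite low1 ?mulr0 ?add0r; last by lia.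
by case: (i) lt_i => [|i'] lt_i; rewrite ?low0 ?mulr0.
Qed.

End Recurrence.

(** * The closed formulas in terms of residual coefficients *)

Section Coefficients.

Variables (K : fieldType) (c : nat -> nat -> K) (b0 : nat -> K).
Variables (A B : nat -> nat -> {poly K}).
Hypotheses (apx : approximants c A B b0) (b00 : b0 0%N = 1).

Lemma predSS k : k.+1%:Z - 2 = k%:Z - 1. Proof. by lia. Qed.
Lemma double_predSS k : 2 * k.+1%:Z - 2 = 2 * k%:Z. Proof. by lia. Qed.
Lemma double_predSSS k : 2 * k.+1%:Z - 3 = 2 * k%:Z - 1. Proof. by lia. Qed.

Lemma jacD_residual N k : (2 * k <= N.+1)%N ->
  jacD c A B k = - (residual c A B N k 0)`_(2 * k)%N.
Proof.
move=> le_kN; rewrite -residual_lead_coef // big_nat1.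
case: k {le_kN} => [|k]; first by rewrite /jacD /errc /bc /= coef0 mul0r addr0 opprK.
have [_ _ B0 _] := apx k 0%N.
by rewrite /jacD /bc predS /= B0 b00 mul1r addrC.
Qed.

Lemma bracket_residual N k : (2 * k < N.+1)%N ->
  bracket c A B k.+1 = - (residual c A B N k 0)`_(2 * k)%N.+1.
Proof.
move=> lt_kN; rewrite -residual_next_coef // big_nat1 subn0 addrC.
by rewrite /bracket predSS double_predSS double_predSSS.
Qed.

Variable k : nat.

Let N := (2 * k.+1)%N.
(* For n = k + 1, u1 and v1 are the coefficients of x^(2n-1) and x^(2n) in    *)
(* A_{n-1} - f B_{n-1}, and u0 and v0 those of x^(2n-3) and x^(2n-2) in       *)
(* A_{n-2} - f B_{n-2}.                                                       *)
Let u1 m := (residual c A B N k.+1 m)`_(2 * k)%N.+2.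
Let v1 m := (residual c A B N k.+1 m)`_(2 * k)%N.+3.
Let u0 m := (residual c A B N k m)`_(2 * k)%N.
Let v0 m := (residual c A B N k m)`_(2 * k)%N.+1.

Lemma lead1 m :
  - errc c A B (k.+1%:Z - 1) m (2 * k.+1%:Z - 1)
  + \sum_(0 <= p < m.+1)
      bc B (k.+1%:Z - 1) 0 p * Defs.coefZ c (2 * k.+1%:Z - 1) (m - p)
  = - u1 m.
Proof. by rewrite (@residual_lead_coef _ _ _ _ N) // mulnS. Qed.

Lemma next1 m :
  - errc c A B (k.+1%:Z - 1) m (2 * k.+1%:Z)
  + \sum_(0 <= p < m.+1)
      (bc B (k.+1%:Z - 1) 0 p * Defs.coefZ c (2 * k.+1%:Z) (m - p)
       + bc B (k.+1%:Z - 1) 1 p * Defs.coefZ c (2 * k.+1%:Z - 1) (m - p))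
  = - v1 m.
Proof. by rewrite (@residual_next_coef _ _ _ _ N) // mulnS. Qed.

Lemma lead0 m :
  - errc c A B (k.+1%:Z - 2) m (2 * k.+1%:Z - 3)
  + \sum_(0 <= p < m.+1)
      bc B (k.+1%:Z - 2) 0 p * Defs.coefZ c (2 * k.+1%:Z - 3) (m - p)
  = - u0 m.
Proof.
by rewrite predSS double_predSSS (@residual_lead_coef _ _ _ _ N) // /N; lia.
Qed.

Lemma next0 m :
  - errc c A B (k.+1%:Z - 2) m (2 * k.+1%:Z - 2)
  + \sum_(0 <= p < m.+1)
      (bc B (k.+1%:Z - 2) 0 p * Defs.coefZ c (2 * k.+1%:Z - 2) (m - p)
       + bc B (k.+1%:Z - 2) 1 p * Defs.coefZ c (2 * k.+1%:Z - 3) (m - p))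
  = - v0 m.
Proof.
rewrite predSS double_predSS double_predSSS (@residual_next_coef _ _ _ _ N) //.
by rewrite /N; lia.
Qed.

Let D1 : jacD c A B k.+1 = - u1 0%N.
Proof. by rewrite (@jacD_residual N) // mulnS. Qed.

Let D0 : jacD c A B k = - u0 0%N.
Proof. by rewrite (@jacD_residual N) // /N; lia. Qed.

Let bracketE : bracket c A B k.+1 = - v0 0%N.
Proof. by rewrite (@bracket_residual N) // /N; lia. Qed.

(** Equivalently, beta is the value that kills the x^(2n) coefficient at m = 0. *)
Lemma beta_residual :
  beta c A B k.+1 = - ((v1 0%N + alpha c A B k.+1 * v0 0%N) / u1 0%N).
Proof.
have [_ _ B0 _] := apx k 0%N.
have := next1 0; rewrite big_nat1 subn0 [bc _ _ 0 _](_ : _ = 1); last first.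
  by rewrite /bc predS /= B0 b00.
rewrite mul1r => v1E; rewrite /beta bracketE D1 -[v1 0%N]opprK -v1E invrN.
by ring.
Qed.

Lemma hsigma_odd_residual m :
  hsigma_odd c A B k.+1 m = - (u1 m + alpha c A B k.+1 * u0 m).
Proof.
rewrite opprD -mulrN -lead1 -lead0 /hsigma_odd big_split /=.
under [X in _ + (_ + X) = _]eq_bigr do rewrite -mulrA.
by rewrite -mulr_sumr; ring.
Qed.

Lemma hsigma_even_residual m :
  hsigma_even c A B k.+1 m =
  - (v1 m + beta c A B k.+1 * u1 m + alpha c A B k.+1 * v0 m).
Proof.
rewrite !opprD -!mulrN -next1 -lead1 -next0 /hsigma_even !mulrDr !mulr_sumr.
rewrite [X in _ = X + _]addrACA [RHS]addrACA -!big_split /=; congr (_ + _).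
  by ring.
by apply: eq_bigr => p _; ring.
Qed.

Variables alphac betac : nat -> nat -> nat -> K.

Lemma csigma_odd_residual m :
  csigma_odd c A B alphac k.+1 m = - \sum_(1 <= p < m) alphac k.+1 m p * u0 p.
Proof. by rewrite -sumrN; apply: eq_bigr => p _; rewrite lead0 mulrN. Qed.

Lemma csigma_even_residual m :
  csigma_even c A B alphac betac k.+1 m =
  - \sum_(1 <= p < m) (betac k.+1 m p * u1 p + alphac k.+1 m p * v0 p).
Proof.
rewrite -sumrN; apply: eq_bigr => p _.
by rewrite lead1 next0 opprD -!mulrN.
Qed.

Hypothesis c_reg : forall n, (0 < n)%N -> pade_mx c n \in unitmx.

Let u1_neq0 : u1 0 != 0.
Proof.
have := @residual_lead_neq0 _ c A B b0 N k.+1 apx b00 c_reg.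
by rewrite [X in _`_X]mulnS; apply; rewrite /N.
Qed.

Let u0_neq0 : u0 0 != 0.
Proof. by apply: residual_lead_neq0 apx b00 c_reg _; rewrite /N; lia. Qed.

(** At m = 0 this is alpha = - u1(0) / u0(0). For m > 0, [sigma_odd] is minus all terms other than
    the p = 0 one, and [F_even] at k is 1 / u0(0). *)
Lemma alphac_balance m :
    ((0 < m)%N ->
       alphac k.+1 m 0%N = F_even c A B k * sigma_odd c A B alphac k.+1 m) ->
  u1 m + alpha c A B k.+1 * u0 m + \sum_(0 <= p < m) alphac k.+1 m p * u0 p = 0.
Proof.
case: m => [_|m /(_ isT) ac0].
  by rewrite big_geq // addr0 /alpha /= D1 D0; field; rewrite ?oppr_eq0 ?u0_neq0 ?u1_neq0.
rewrite big_ltn // ac0 /sigma_odd hsigma_odd_residual csigma_odd_residual.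
rewrite (_ : F_even c A B k = (u0 0%N)^-1); last first.
  rewrite /F_even; case: eqP D0 => [-> | _ ->]; last by rewrite invrN opprK.
  by rewrite /jacD /= => D0k; rewrite -[u0 0%N]opprK -D0k invrN invr1.
by field; rewrite ?oppr_eq0 ?u0_neq0 ?u1_neq0.
Qed.

(** With alphac_0 known, the equation is solved for betac_0 by dividing by u1(0); [F_odd] carries
    the contribution of alphac_0 v0(0). *)
Lemma betac_balance m :
    ((0 < m)%N ->
       alphac k.+1 m 0%N = F_even c A B k * sigma_odd c A B alphac k.+1 m) ->
    ((0 < m)%N ->
       betac k.+1 m 0%N = F_odd c A B k.+1 * sigma_odd c A B alphac k.+1 m
         + F_even c A B k.+1 * sigma_even c A B alphac betac k.+1 m) ->
  v1 m + beta c A B k.+1 * u1 m + alpha c A B k.+1 * v0 m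
  + \sum_(0 <= p < m) (betac k.+1 m p * u1 p + alphac k.+1 m p * v0 p) = 0.
Proof.
case: m => [_ _|m /(_ isT) ac0 /(_ isT) bc0].
  by rewrite big_geq // addr0 beta_residual; field; rewrite ?oppr_eq0 ?u0_neq0 ?u1_neq0.
have F_oddE : F_odd c A B k.+1 = - (F_even c A B k * v0 0%N / u1 0%N).
  rewrite /F_odd ltnS leqn0 /tau bracketE D1 /=; case: eqP => [k0|_]; last by field; rewrite ?oppr_eq0 ?u0_neq0 ?u1_neq0.
  (* For n = 1 the convention F_odd = 0 agrees with the general formula, since - x^(-1) has no
     constant term. *)
  suff -> : v0 0%N = 0 by rewrite mulr0 mul0r oppr0.
  rewrite -[v0 0%N]opprK -bracketE k0 /bracket predSS double_predSS /errc /bc.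
  by rewrite /= !coef0 !mul0r !addr0 subr0 oppr0.
have F_evenE : F_even c A B k.+1 = (u1 0%N)^-1.
  by rewrite /F_even D1 invrN opprK.
rewrite big_ltn // ac0 bc0 F_oddE F_evenE /sigma_even.
rewrite hsigma_even_residual csigma_even_residual.
by field; rewrite ?oppr_eq0 ?u0_neq0 ?u1_neq0.
Qed.

End Coefficients.

(** * Construction of the coefficients and conclusion *)

Theorem proposition2p1 (K : fieldType) (c : nat -> nat -> K) (b0 : nat -> K)
    (A B : nat -> nat -> {poly K}) :
  c 0%N 0%N = 0 ->
  (forall n : nat, (0 < n)%N -> pade_mx c n \in unitmx) ->
  b0 0%N = 1 ->
  approximants c A B b0 ->
  exists alphac betac : nat -> nat -> nat -> K,
    forall m n : nat, (0 < m)%N -> (0 < n)%N ->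
    [/\ extA A n%:Z m =
          (1 + beta c A B n *: 'X)%:F * extA A (n%:Z - 1) m
          + (alpha c A B n *: 'X^2)%:F * extA A (n%:Z - 2) m
          + checkA A alphac betac n m,
        extB B n%:Z m =
          (1 + beta c A B n *: 'X) * extB B (n%:Z - 1) m
          + (alpha c A B n *: 'X^2) * extB B (n%:Z - 2) m
          + checkB B alphac betac n m,
        betac n m 0%N =
          F_odd c A B n * sigma_odd c A B alphac n m
          + F_even c A B n * sigma_even c A B alphac betac n m,
        alphac n m 0%N = F_even c A B n.-1 * sigma_odd c A B alphac n m
      & forall p s : nat, (1 <= s <= p)%N -> (1 <= p <= m.-1)%N ->
          betac n m p = betac n (m - s)%N (p - s)%N /\
          alphac n m p = alphac n (m - s)%N (p - s)%N].
Proof.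
move=> _ c_reg b00 apx.
(* Index 0 holds the Jacobi coefficients, so that the sums in [nextA] and [nextB] absorb them as
   their p = m terms. *)
pose step n m (f : nat -> K * K) : K * K :=
  if m is 0 then (alpha c A B n, beta c A B n) else
  let ac (_ m p : nat) := (f (m - p)%N).1 in
  let bc (_ m p : nat) := (f (m - p)%N).2 in
  (F_even c A B n.-1 * sigma_odd c A B ac n m,
   F_odd c A B n * sigma_odd c A B ac n m
   + F_even c A B n * sigma_even c A B ac bc n m).
pose ab n := strong_rec (0, 0) (step n).
have abE n m : ab n m = step n m (ab n).
  apply: strong_recE => {}m f g eq_fg; case: m eq_fg => //= m eq_fg.
  have eq_odd ac ac' : (forall p, (1 <= p < m.+1)%N -> ac n m.+1 p = ac' n m.+1 p) ->
      sigma_odd c A B ac n m.+1 = sigma_odd c A B ac' n m.+1.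
    by move=> eq_ac; congr (_ + _); apply: eq_big_nat => p /eq_ac->.
  (* The sigmas use only p >= 1, hence only indices m+1-p below m+1. *)
  have eq_f p : (1 <= p < m.+1)%N -> f (m.+1 - p)%N = g (m.+1 - p)%N.
    by move=> lt_p; apply: eq_fg; lia.
  rewrite (eq_odd _ (fun _ m p => (g (m - p)%N).1)); last by move=> p /eq_f->.
  congr (_, _ + _ * (_ + _)); apply: eq_big_nat => p /eq_f.
  by rewrite /= => ->.
(* Depending on m and p only through m - p makes the copy relations automatic. *)
pose alphac n m p := (ab n (m - p)%N).1; pose betac n m p := (ab n (m - p)%N).2.
have alphac0 n m : (0 < m)%N ->
    alphac n m 0%N = F_even c A B n.-1 * sigma_odd c A B alphac n m.
  by case: m => // m _; rewrite /alphac subn0 abE.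
have betac0 n m : (0 < m)%N ->
    betac n m 0%N = F_odd c A B n * sigma_odd c A B alphac n m
      + F_even c A B n * sigma_even c A B alphac betac n m.
  by case: m => // m _; rewrite /betac subn0 abE.
have ab0 n : ab n 0%N = (alpha c A B n, beta c A B n) by rewrite abE.
exists alphac, betac => m [//|k] m_gt0 _.
pose a j := (ab k.+1 j).1; pose b j := (ab k.+1 j).2.
have next_apx : approximants_at c b0 k.+1 (nextA A k a b) (nextB B k a b).
  apply: next_approximants_at => // l.
    apply: etrans (alphac_balance apx b00 c_reg (alphac0 k.+1 l)).
    by rewrite big_ord_recr /= subnn /a ab0 big_mkord /= addrA addrAC.
  apply: etrans (betac_balance apx b00 c_reg (alphac0 k.+1 l) (betac0 k.+1 l)).
  rewrite big_ord_recr /= subnn /a /b ab0 big_mkord /=.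
  by rewrite [X in _ + X]addrC !addrA.
have [defA defB] := approximants_at_uniq c_reg (apx k.+1) next_apx m.
split.
- have shiftF d p : ((d *: 'X) * shiftA A k p)%:F
      = (d *: 'X^2)%:F * extA A (k%:Z - 1) p.
    by rewrite tofracM extA_pred mulrA -tofracM expr2 scalerAl.
  rewrite /checkA predS predSS [LHS]/= defA /nextA big_ord_recr /= subnn /a /b ab0.
  rewrite /= !tofracD (big_morph _ (@tofracD _) (@tofrac0 _)) big_mkord shiftF mulrDl tofrac1 mul1r tofracM.
  under eq_bigr do rewrite tofracD shiftF tofracM.
  by rewrite [X in _ + X]addrC !addrA.
- rewrite /checkB predS predSS [LHS]/= defB /nextB big_ord_recr /= subnn /a /b ab0.
  by rewrite /= mulrDl mul1r big_mkord [X in _ + X]addrC !addrA.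
- exact: betac0.
- exact: alphac0.
move=> p s lt_sp lt_pm; rewrite /alphac /betac.
by rewrite (_ : m - s - (p - s) = m - p)%N //; lia.
Qed.
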